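(* Let $\mathcal{S} \subset \mathbb{R}^2$ be a finite set (of stations), let $W \subset \mathbb{R}^2$ be a non-empty, bounded, open set, let $(C(s))_{s\in\mathcal{S}}$ be Borel sets forming a partition of $W$, let $\widehat\lambda : W \to [0,\infty)$ be integrable, and put $\Lambda(s) = \int_{C(s)} \widehat\lambda(u)\,du$ for $s \in \mathcal{S}$. Let $\alpha \in \{2,3,\dots\}$, and for each $s\in\mathcal{S}$ let $n(s)$ be an integer. Suppose that $n(s) \geq 1$ and $\Lambda(s) > 0$ for all $s \in \mathcal{S}$, and let $K$ be an integer with \[ \alpha |\mathcal{S}| \leq K < \alpha \sum_{s\in\mathcal{S}} n(s). \] Let $f = f_K : \mathcal{S} \to \mathbb{N}$ be the output of any run of the greedy personnel allocation algorithm (defined in the context), stopped when $K$ units have been allocated. Then $\alpha \leq f(s) \leq \alpha\, n(s)$ for all $s\in\mathcal{S}$, $\sum_{s\in\mathcal{S}} f(s) = K$, and $f$ minimises the maximal average risk under these constraints, that is, \[ \max_{s\in\mathcal{S}} \frac{\Lambda(s)}{\lfloor f(s)/\alpha \rfloor} \;\leq\; \max_{s\in\mathcal{S}} \frac{\Lambda(s)}{\lfloor g(s)/\alpha \rfloor} \] for every $g:\mathcal{S}\to\mathbb{N}$ such that $\alpha \leq g(s) \leq \alpha\, n(s)$ for all $s\in\mathcal{S}$ and $\sum_{s\in\mathcal{S}} g(s) = K$.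
   Context: Here $\mathbb{N} = \{1,2,\dots\}$, $|\cdot|$ denotes cardinality and $\lfloor x \rfloor$ is the largest integer less than or equal to $x$. The number $\Lambda(s)$ is the (estimated) total risk in the catchment area $C(s)$ of station $s$, $\widehat\lambda$ being an estimator of the intensity function of incidents; $n(s)$ is the number of vehicles already placed at station $s$; $\alpha$ is the crew size needed to operate one vehicle; $f(s)$ is the number of people assigned to $s$; and $K$ is the total number of crew members. Greedy personnel allocation algorithm. Initialise by allocating $\alpha$ units to every station: $f_{\alpha|\mathcal{S}|}(s) = \alpha$ for all $s\in\mathcal{S}$. Given $(f_k(s))_{s\in\mathcal{S}}$, the allocation after $k$ units have been allocated ($\alpha|\mathcal{S}| \leq k < K$), choose a station $s^*$ that maximises \[ \frac{\Lambda(s)}{\lfloor f_k(s)/\alpha \rfloor} \] over all $s \in \mathcal{S}$ with $f_k(s) < \alpha\, n(s)$. In case of ties among the maximisers, preference is given to those stations $s$ for which $f_k(s) \bmod \alpha$ is largest (if several such stations remain, any of them may be chosen). Set $f_{k+1}(s^* ) = f_k(s^* ) + 1$ and $f_{k+1}(s) = f_k(s)$ for $s \neq s^*$. The output is $f_K$. *)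

(* Defs.v *)
From HB Require Import structures.
From mathcomp Require Import all_boot all_order all_algebra finmap.
From mathcomp Require Import all_classical all_reals all_analysis.

Set Implicit Arguments.
Unset Strict Implicit.
Unset Printing Implicit Defensive.

Import Order.TTheory GRing.Theory Num.Theory numFieldNormedType.Exports.

Local Open Scope classical_set_scope.
Local Open Scope ring_scope.

Definition borel_set (T : topologicalType) (B : set T) : Prop :=
  <<s [set U : set T | open U] >> B.

Definition lebesgue2 (R : realType) :=
  (@lebesgue_measure R \x @lebesgue_measure R)%E.

(* [lambda] only matters on the union of the sets [C s]; it is a total
   function because integrals are taken over subsets of the whole plane. *)
Definition total_risk (R : realType) (T : Type) (C : T -> set (R * R))
    (lambda : R * R -> R) (s : T) : R :=
  (\int[@lebesgue2 R]_(u in C s) lambda u)%R.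

Section Allocation.
Context {R : realType} {T : finType}.
Implicit Types (Lambda : T -> R) (alpha K : nat) (n f : T -> nat) (s t : T).

(* [%/] is Euclidean division, i.e. the floor of the quotient. *)
Definition average_risk Lambda alpha f s : R :=
  Lambda s / (f s %/ alpha)%N%:R.

(* The neutral element 0 does not affect the maximum as long as [T] is
   non-empty and [Lambda] is nonnegative. *)
Definition max_average_risk Lambda alpha f : R :=
  \big[Num.max/0]_(s : T) average_risk Lambda alpha f s.

Definition admissible alpha n K f : Prop :=
  (forall s, (alpha <= f s <= alpha * n s)%N) /\ (\sum_(s : T) f s = K)%N.

Definition greedy_choice Lambda alpha n f s : Prop :=
  [/\ (f s < alpha * n s)%N,
      forall t, (f t < alpha * n t)%N ->
        average_risk Lambda alpha f t <= average_risk Lambda alpha f s &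
      forall t, (f t < alpha * n t)%N ->
        average_risk Lambda alpha f t = average_risk Lambda alpha f s ->
        (f t %% alpha <= f s %% alpha)%N].

(* [f_ k] is the allocation after [k] units have been allocated; its values
   for [k] outside of [alpha * #|T|, K] are irrelevant. *)
Definition greedy_run Lambda alpha n K (f_ : nat -> T -> nat) : Prop :=
  (forall s, f_ (alpha * #|T|)%N s = alpha) /\
  (forall k, (alpha * #|T| <= k < K)%N ->
    exists s, [/\ greedy_choice Lambda alpha n (f_ k) s,
      f_ k.+1 s = (f_ k s + 1)%N &
      forall t, t <> s -> f_ k.+1 t = f_ k t]).

End Allocation.

(* Main.v *)
(* If an admissible [g] had a smaller maximum than the greedy output [f], some
   station [s0] would have a risk under [f] above the whole maximum for [g].
   Then [s0] has fewer complete crews under [f] than under [g], so it is never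
   full during the run, and each unit is given to a station whose risk is at
   least the final risk of [s0]. Such a station has fewer complete crews than
   in [g], so the run never exceeds [g] anywhere; as it stays strictly below [g]
   at [s0], the two totals cannot both be [K]. *)
Require Import Defs.
From mathcomp Require Import all_boot all_order all_algebra finmap.
From mathcomp Require Import all_classical all_reals all_analysis.

Set Implicit Arguments.
Unset Strict Implicit.
Unset Printing Implicit Defensive.

Import Order.TTheory GRing.Theory Num.Theory numFieldNormedType.Exports.

Local Open Scope classical_set_scope.
Local Open Scope ring_scope.

(** Only stations strictly below capacity are eligible, so adding one unit keeps the upper bound; at
    the start this bound comes from [n s] being positive. *)
Lemma greedy_run_admissible (R : realType) (T : finType) (Lambda : T -> R)
    (alpha K : nat) (n : T -> nat) (f_ : nat -> T -> nat) :
  (forall s, 0 < n s)%N -> greedy_run Lambda alpha n K f_ ->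
  forall k, (alpha * #|T| <= k <= K)%N -> admissible alpha n k (f_ k).
Proof.
move=> n_gt0 [f_init f_step].
have base : admissible alpha n (alpha * #|T|) (f_ (alpha * #|T|)%N).
  split=> [s|]; first by rewrite f_init leqnn leq_pmulr.
  by rewrite (eq_bigr _ (fun s _ => f_init s)) sum_nat_const mulnC.
(* The induction starts at 0, not at [alpha * #|T|]: [base] applies when that product is 0 or when
   it equals [k.+1]. *)
move=> k /andP[]; elim: k => [|k IHk].
  by rewrite leqn0 => /eqP k0 _; rewrite k0 in base.
rewrite leq_eqVlt => /predU1P[<- //|]; rewrite ltnS => lek ltkK.
have [bnd sumk] := IHk lek (ltnW ltkK).
have [|s [[fs_lt _ _] fs ft]] := f_step k; first by rewrite lek.
split=> [t|].
  have [->|/eqP ts] := eqVneq t s; last by rewrite ft.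
  rewrite fs addn1 fs_lt andbT (leq_trans _ (leqnSn _))//.
  by case/andP: (bnd s).
have fE t : t != s -> f_ k.+1 t = f_ k t by move/eqP => ts; rewrite ft.
rewrite -[in RHS]sumk (bigD1 s)//= [in RHS](bigD1 s)//= fs addn1.
by rewrite (eq_bigr _ fE).
Qed.

(** Carries a bound on the final allocation of a station back to all earlier stages. *)
Lemma greedy_run_mono (R : realType) (T : finType) (Lambda : T -> R)
    (alpha K : nat) (n : T -> nat) (f_ : nat -> T -> nat) (s : T) (j k : nat) :
  greedy_run Lambda alpha n K f_ -> (alpha * #|T| <= j)%N ->
  (j <= k <= K)%N -> (f_ j s <= f_ k s)%N.
Proof.
move=> [_ f_step] lej /andP[]; elim: k => [|k IHk].
  by rewrite leqn0 => /eqP->.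
rewrite leq_eqVlt => /predU1P[->//|]; rewrite ltnS => lejk ltkK.
apply: leq_trans (IHk lejk (ltnW ltkK)) _.
have [|t [_ ft fu]] := f_step k; first by rewrite (leq_trans lej).
have [->|/eqP st] := eqVneq s t; last by rewrite fu.
by rewrite ft leq_addr.
Qed.

(** Cancelling [Lambda s] and inverting gives strictly fewer complete crews in [f]; for floors this
    means that [f s] is below the units of [g s] that fill complete crews. *)
Lemma ltn_of_average_risk (R : realType) (T : finType) (Lambda : T -> R)
    (alpha : nat) (f g : T -> nat) (s : T) :
  0 < Lambda s -> (0 < alpha)%N -> (alpha <= f s)%N -> (alpha <= g s)%N ->
  average_risk Lambda alpha g s < average_risk Lambda alpha f s ->
  (f s < alpha * (g s %/ alpha))%N.
Proof.
move=> L_gt0 a_gt0 af ag; rewrite /average_risk ltr_pM2l// ltf_pV2.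
- by rewrite ltr_nat mulnC ltn_divLR.
- by rewrite posrE ltr0n divn_gt0.
- by rewrite posrE ltr0n divn_gt0.
Qed.

(** The bound [alpha <= f s] keeps the divisor away from 0, where the risk would default to 0. *)
Lemma average_risk_antimono (R : realType) (T : finType) (Lambda : T -> R)
    (alpha : nat) (f g : T -> nat) (s : T) :
  0 <= Lambda s -> (0 < alpha)%N -> (alpha <= f s)%N -> (f s <= g s)%N ->
  average_risk Lambda alpha g s <= average_risk Lambda alpha f s.
Proof.
move=> L_ge0 a_gt0 af fg; rewrite ler_wpM2l// lef_pV2.
- by rewrite ler_nat leq_div2r.
- by rewrite posrE ltr0n divn_gt0// (leq_trans af).
- by rewrite posrE ltr0n divn_gt0.
Qed.

Lemma greedy_run_optimal (R : realType) (T : finType) (Lambda : T -> R)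
    (alpha K : nat) (n : T -> nat) (f_ : nat -> T -> nat) (g : T -> nat) :
  (0 < alpha)%N -> (forall s, 0 < n s)%N -> (forall s, 0 < Lambda s) ->
  (alpha * #|T| <= K)%N -> greedy_run Lambda alpha n K f_ ->
  admissible alpha n K g ->
  max_average_risk Lambda alpha (f_ K) <= max_average_risk Lambda alpha g.
Proof.
move=> a_gt0 n_gt0 L_gt0 leK run [g_bnd g_sum].
have adm := greedy_run_admissible n_gt0 run.
have [fK_bnd fK_sum] : admissible alpha n K (f_ K) by apply: adm; rewrite leK/=.
have ag s : (alpha <= g s)%N by case/andP: (g_bnd s).
apply: bigmax_le => [|s0 _]; first exact: bigmax_ge_id.
rewrite leNgt; apply/negP => lt_max.
have g_lt s :
    average_risk Lambda alpha g s < average_risk Lambda alpha (f_ K) s0.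
  by apply: le_lt_trans lt_max; exact: le_bigmax.
have fK_lt : (f_ K s0 < alpha * (g s0 %/ alpha))%N.
  by apply: ltn_of_average_risk (g_lt s0) => //; case/andP: (fK_bnd s0).
have full_le s : (alpha * (g s %/ alpha) <= g s)%N by rewrite mulnC leq_divM.
(* The invariant counts only units of [g] in complete crews; it holds initially because [g] has at
   least one crew everywhere. *)
have f_le k : (alpha * #|T| <= k <= K)%N ->
    forall s, (f_ k s <= alpha * (g s %/ alpha))%N.
  have [f_init f_step] := run.
  have base s : (f_ (alpha * #|T|) s <= alpha * (g s %/ alpha))%N.
    by rewrite f_init leq_pmulr// divn_gt0.
  case/andP; elim: k => [|k IHk].
    by rewrite leqn0 => /eqP k0 _; rewrite k0 in base.
  rewrite leq_eqVlt => /predU1P[<-//|]; rewrite ltnS => lek ltkK s.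
  have [fk_bnd _] : admissible alpha n k (f_ k) by apply: adm; rewrite lek ltnW.
  have [|t [[_ t_max _] ft fu]] := f_step k; first by rewrite lek.
  have [->|/eqP st] := eqVneq s t; last by rewrite fu// IHk// ltnW.
  rewrite ft addn1; apply: (@ltn_of_average_risk _ _ Lambda) => //.
    by case/andP: (fk_bnd t).
  have fk_le : (f_ k s0 <= f_ K s0)%N.
    by apply: greedy_run_mono run lek _; rewrite leqnn (ltnW ltkK).
  (* Risk of [t] under [g] < final risk of [s0] <= risk of [s0] at stage [k] <= risk of the chosen
     [t] at stage [k]. *)
  apply: lt_le_trans (g_lt t) (le_trans _ (t_max s0 _)).
    by apply: average_risk_antimono => //; [exact: ltW|case/andP: (fk_bnd s0)].
  (* The maximality of [t] applies to [s0] because [s0] is still below capacity at stage [k]. *)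
  apply: leq_ltn_trans fk_le (leq_trans fK_lt (leq_trans (full_le _) _)).
  by case/andP: (g_bnd s0).
have : (\sum_s f_ K s < \sum_s g s)%N.
  rewrite (bigD1 s0)//= [ltnRHS](bigD1 s0)//= -addSn leq_add//.
    exact: leq_trans fK_lt _.
  by apply: leq_sum => s _; apply: leq_trans (full_le s); rewrite f_le// leK/=.
by rewrite fK_sum g_sum ltnn.
Qed.

Theorem theorem5p1 (R : realType) (S : {fset (R * R)%type})
    (W : set (R * R)) (C : S -> set (R * R)) (lambda : R * R -> R)
    (alpha : nat) (n : S -> nat) (K : nat) (f_ : nat -> S -> nat) :
  W !=set0 -> bounded_set W -> open W ->
  (forall s, borel_set (C s)) -> partition [set: S] C W ->
  (forall u, W u -> 0 <= lambda u) ->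
  (@lebesgue2 R).-integrable W (EFin \o lambda) ->
  (2 <= alpha)%N ->
  (forall s, (1 <= n s)%N) ->
  (forall s, 0 < total_risk C lambda s) ->
  (alpha * #|` S| <= K < alpha * \sum_(s : S) n s)%N ->
  greedy_run (total_risk C lambda) alpha n K f_ ->
  let f := f_ K in
  admissible alpha n K f /\
  (forall g : S -> nat, admissible alpha n K g ->
     max_average_risk (total_risk C lambda) alpha f
       <= max_average_risk (total_risk C lambda) alpha g).
Proof.
move=> _ _ _ _ _ _ _ a_ge2 n_gt0 L_gt0 /andP[leK _] run f.
have a_gt0 : (0 < alpha)%N by exact: ltnW.
(* The cardinality of the finite set [S] becomes that of its type of elements, over which the run is
   defined. *)
rewrite cardfE in leK; split=> [|g].
  by apply: greedy_run_admissible n_gt0 run _ _; rewrite leK/=.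
exact: (greedy_run_optimal a_gt0 n_gt0 L_gt0 leK run).
Qed.
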